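(* Let $f$ be a real-valued functional of ordered (or unordered) rooted trees and let $F(\Lambda):=\sum_{v\in\Lambda}f(\Lambda(v))$. Assume that $$\sum_{k=1}^\infty\frac{(\mathrm{Var} f(\Lambda_k))^{1/2}}{k^{3/2}}<\infty,\qquad \lim_{k\to\infty}\frac{\mathrm{Var} f(\Lambda_k)}{k}=0,\qquad \sum_{k=1}^\infty\frac{(\mathbb{E} f(\Lambda_k))^2}{k^2}<\infty,$$ and let $\hat\sigma_F^2:=\lim_{n\to\infty}\mathrm{Var}(F(\Lambda_n))/n$. Suppose in addition that $f(\Lambda)=f(|\Lambda|,d(\Lambda),|\Lambda_{v_1}|,\dots,|\Lambda_{v_{d(\Lambda)}}|)$ depends only on the size $|\Lambda|$ and the number and sizes of the principal subtrees. Let $\nu_k:=\mathbb{E} F(\Lambda_k)$, and let $$\psi_k:=\mathrm{Var}\Bigl(f\bigl(k,d(\Lambda_k),|\Lambda_{k,1}|,\dots,|\Lambda_{k,d(\Lambda_k)}|\bigr)+\sum_{i=1}^{d(\Lambda_k)}\nu_{|\Lambda_{k,i}|}\Bigr)=\mathbb{E}\Bigl(f\bigl(k,d(\Lambda_k),|\Lambda_{k,1}|,\dots,|\Lambda_{k,d(\Lambda_k)}|\bigr)+\sum_{i=1}^{d(\Lambda_k)}\nu_{|\Lambda_{k,i}|}-\nu_k\Bigr)^2,$$ where $\Lambda_{k,1},\dots,\Lambda_{k,d(\Lambda_k)}$ are the principal subtrees of $\Lambda_k$. Then $$\hat\sigma_F^2=\sum_{k=1}^\infty\frac{1}{k(k+1)}\psi_k<\infty.$$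 Moreover, $\hat\sigma_F^2>0$ unless $\mathrm{Var} F(\Lambda_n)=0$ for every $n\ge1$; this happens if and only if $f(n,d,n_1,\dots,n_d)=a_n-\sum_{i=1}^d a_{n_i}$ (for all possible values of $n,d,n_1,\dots,n_d$, i.e. $n\ge1$, $d\ge0$, $n_i\ge1$, $n_1+\dots+n_d=n-1$) for some real numbers $a_n$, $n\ge0$.
   Context: Random recursive tree $\Lambda_n$: start with a root labelled $1$; for $i=2,\dots,n$, node $i$ is attached as a child of a uniformly random node among $1,\dots,i-1$ (independently of earlier choices). It is regarded as an ordered rooted tree by ordering the children of each node by increasing labels from left to right and then ignoring the labels, or as an unordered rooted tree by ignoring also the ordering. $|\Lambda|$ is the number of nodes of $\Lambda$. $\Lambda(v)$ is the fringe subtree of $\Lambda$ rooted at $v$ ($v$ together with all its descendants). $d(\Lambda)$ is the degree (number of children) of the root; if $v_1,\dots,v_{d(\Lambda)}$ are the children of the root (in order, for an ordered tree), the principal subtrees of $\Lambda$ are $\Lambda_{v_i}=\Lambda(v_i)$. Under the three displayed assumptions on $f$ the limit $\hat\sigma_F^2$ exists and is finite; in the paper $\hat\sigma_F^2$ is equivalently defined as $\lim_{N\to\infty}\sum_{|\Lambda|,|\Lambda'|\le N}f(\Lambda)f(\Lambda')\hat\sigma_{\Lambda,\Lambda'}$, where $\hat\sigma_{\Lambda,\Lambda'}$ is $\mathrm{Cov}(\hat X_n^\Lambda,\hat X_n^{\Lambda'})/n$ (constant for $n>|\Lambda|+|\Lambda'|$) and $\hat X_n^\Lambda$ is the number of fringe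 subtrees of $\Lambda_n$ isomorphic to $\Lambda$. *)

(* Defs.v *)
From HB Require Import structures.
From mathcomp Require Import all_boot all_order all_algebra.
From mathcomp Require Import all_classical all_reals all_analysis.

Set Implicit Arguments.
Unset Strict Implicit.
Unset Printing Implicit Defensive.

Import Order.TTheory GRing.Theory Num.Theory.
Import numFieldNormedType.Exports.

Local Open Scope ring_scope.

(* Ordered rooted trees.  A functional of unordered rooted trees is a
   functional on [tree] that is invariant under permuting the children of
   nodes, so quantifying over all [f : tree -> R] covers both settings. *)
Inductive tree : Type := Node of seq tree.

Definition children (t : tree) : seq tree := let: Node ts := t in ts.

Fixpoint tree_size (t : tree) : nat :=
  let: Node ts := t in (sumn (map tree_size ts)).+1.

Definition root_degree (t : tree) : nat := size (children t).

Definition principal_sizes (t : tree) : seq nat := map tree_size (children t).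

(* The fringe subtrees t(v), one entry for each node v of t. *)
Fixpoint fringe_subtrees (t : tree) : seq tree :=
  let: Node ts := t in t :: flatten (map fringe_subtrees ts).

Inductive labelled_tree : Type := LNode of nat & seq labelled_tree.

(* Adds a leaf labelled [new] as last child of the node labelled [parent]; when
   [new] exceeds all labels present, children stay sorted by label. *)
Fixpoint attach (parent new : nat) (t : labelled_tree) : labelled_tree :=
  let: LNode l ts := t in
  LNode l (map (attach parent new) ts ++
           (if l == parent then [:: LNode new [::]] else [::])).

Fixpoint forget_labels (t : labelled_tree) : tree :=
  let: LNode _ ts := t in Node (map forget_labels ts).

(* [choices m] is the product of 'I_1, ..., 'I_m: the successive parent choices
   that build a recursive tree with m + 1 nodes, labelled 0, ..., m.  The
   uniform distribution on it makes the choices independent and uniform. *)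
Fixpoint choices (m : nat) : finType :=
  if m is m'.+1 then (choices m' * 'I_m'.+1)%type : finType else unit : finType.

Fixpoint recursive_tree (m : nat) : choices m -> labelled_tree :=
  match m with
  | 0 => fun _ => LNode 0 [::]
  | m'.+1 => fun c => attach c.2 m'.+1 (recursive_tree c.1)
  end.

Section RandomRecursiveTree.
Variable R : realType.
Implicit Types (f X : tree -> R) (g : nat -> nat -> seq nat -> R) (n k : nat).

(* Expectation and variance of X(Lambda_n), where Lambda_n is the random
   recursive tree with n nodes; only meaningful for n >= 1. *)
Definition rrt_mean n X : R :=
  (\sum_(c : choices n.-1) X (forget_labels (recursive_tree c)))
    / #|choices n.-1|%:R.

Definition rrt_var n X : R := rrt_mean n (fun t => (X t - rrt_mean n X) ^+ 2).

Definition additive_functional f (t : tree) : R :=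
  \sum_(s <- fringe_subtrees t) f s.

Definition nu f k : R := rrt_mean k (additive_functional f).

Definition psi_variable f g k (t : tree) : R :=
  g k (root_degree t) (principal_sizes t) + \sum_(m <- principal_sizes t) nu f m.

Definition psi f g k : R := rrt_var k (psi_variable f g k).

Definition sigma2 f : R :=
  limn (fun n => rrt_var n (additive_functional f) / n%:R).

End RandomRecursiveTree.

(* Main.v *)
Require Import Defs.
From HB Require Import structures.
From mathcomp Require Import all_boot all_order all_algebra.
From mathcomp Require Import all_classical all_reals all_analysis.
From mathcomp Require Import ring lra zify.

(** Write [V n] for the variance of the additive functional [F] on the random
    recursive tree with [n] nodes.

    The principal subtrees are, given their sizes, independent random recursive
    trees, and on average there are [1 / m] of them with [m] nodes.  Since the
    toll [f] depends only on these sizes, the law of total variance gives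
    [V n = psi n + \sum_(1 <= m < n) V m / m] ([rrt_var_forest],
    [psi_excess]).  Divided by [n] this recursion telescopes to
    [V n / n = psi n / n + \sum_(1 <= k < n) psi k / (k (k + 1))]
    ([var_additiveE]).  So everything about the limit follows once the series
    converges and [psi n / n] tends to [0].

    For this, [psi n] is at most twice the variance of [f] plus twice the variance
    of the sum of [nu] over the principal sizes.  The conditions on the variance of
    [f] handle the first part.  The second is at most
    [6 * \sum_(1 <= j < n) mu j ^ 2 / j], where [mu j] is the mean of [f]
    on trees with [j] nodes ([rrt_var_principal_sizes]).  Indeed
    [nu j = mu j + j * c j], where the increments of [c] are of the small order
    [mu j / j ^ 2], and a constant [c] would contribute nothing to the variance,
    the sizes having a constant sum.  The condition on the means makes the bound
    summable against [1 / (k (k + 1))] and, by Kronecker's lemma, [o(n)].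

    The probabilistic input is a single recursion, [rrt_mean_graft]: cutting the
    edge between the first two nodes of a random recursive tree gives two
    independent random recursive trees of uniform sizes.

    The limit, being the sum of a series with nonnegative terms, vanishes only if
    every [psi k] does, that is, by the recursion, if every [V n] does.  Then [F]
    is a function of the size, as every tree has positive probability, and the
    shape of [f] can be read off from [F] at the root and at its children. *)

Set Implicit Arguments.
Unset Strict Implicit.
Unset Printing Implicit Defensive.

Import Order.TTheory GRing.Theory Num.Theory.
Import numFieldNormedType.Exports.
Local Open Scope classical_set_scope.
Local Open Scope ring_scope.

(** * Ordered trees and the growth process *)

(** Every ordered tree with at least two nodes is [graft a b] for a unique pair
    [(a, b)]: [a] is the first principal subtree and [b] is what remains.  In a
    recursive tree [a] is rooted at the second node, so this is the effect of
    cutting the edge between the first two nodes. *)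
Definition graft (a b : tree) : tree := Node (a :: children b).

Lemma graft_ind (P : tree -> Prop) :
  P (Node [::]) -> (forall a b, P a -> P b -> P (graft a b)) -> forall t, P t.
Proof.
move=> P0 PS; fix IH 1; case=> ts.
by elim: ts => [//|a bs IHbs]; exact: (PS a (Node bs) (IH a) IHbs).
Qed.

Lemma tree_size_gt0 t : (0 < tree_size t)%N.
Proof. by case: t. Qed.

Lemma tree_size_graft a b : tree_size (graft a b) = (tree_size a + tree_size b)%N.
Proof. by case: b => bs; rewrite /graft /= addnS. Qed.

Lemma tree_of_size m : (0 < m)%N -> exists t, tree_size t = m.
Proof.
case: m => // m _; exists (Node (nseq m (Node [::]))) => /=.
by congr _.+1; elim: m => //= m ->.
Qed.

Lemma forest_of_sizes ns : all (fun m => 0 < m)%N ns ->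
  exists ts, map tree_size ts = ns.
Proof.
elim: ns => [_|n ns IH /= /andP[/tree_of_size[t <-] /IH[ts <-]]]; first by exists [::].
by exists (t :: ts).
Qed.

Lemma labelled_graft_ind (P : labelled_tree -> Prop) :
  (forall l, P (LNode l [::])) ->
  (forall l a bs, P a -> P (LNode l bs) -> P (LNode l (a :: bs))) ->
  forall t, P t.
Proof.
move=> P0 PS; fix IH 1; case=> l ts.
by elim: ts => [|a bs IHbs]; [exact: P0 | exact: PS (IH a) IHbs].
Qed.

(** The trees that the next step of the growth process can produce, one for each
    node of [t].  The inner recursion follows [graft], which makes the process
    commute with cutting the first edge: the new leaf falls on one of the two
    sides. *)
Fixpoint grow (t : tree) : seq tree :=
  let: Node ts := t in
  (fix grow_forest ts := match ts with
   | [::] => [:: Node [:: Node [::]]]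
   | a :: bs => [seq Node (a' :: bs) | a' <- grow a] ++
                [seq graft a b' | b' <- grow_forest bs]
   end) ts.

Lemma grow_graft a b :
  grow (graft a b) = [seq graft a' b | a' <- grow a] ++
                     [seq graft a b' | b' <- grow b].
Proof. by case: b. Qed.

Fixpoint labels (t : labelled_tree) : seq nat :=
  let: LNode l ts := t in l :: flatten (map labels ts).

Lemma size_labels t : size (labels t) = tree_size (forget_labels t).
Proof.
elim/labelled_graft_ind: t => [//|l a bs IHa IHb] /=.
by rewrite size_cat IHa; move: IHb => /= [->].
Qed.

(** Counting by an arbitrary predicate needs no hypothesis on the labels, and it
    determines the multiset of labels. *)
Lemma count_labels_attach (P : pred nat) p new t :
  count P (labels (attach p new t)) =
  (count P (labels t) + count_mem p (labels t) * P new)%N.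
Proof.
elim/labelled_graft_ind: t => [l|l a bs IHa IHb] /=.
  by case: (l == p) => /=; rewrite ?addn0 ?mul1n.
move: IHb => /=; rewrite !count_cat IHa.
set x := count P _; set y := count P _.
set z := count_mem p _; set w := count_mem p _.
by nia.
Qed.

Lemma attach_notin p new t : p \notin labels t -> attach p new t = t.
Proof.
elim/labelled_graft_ind: t => [l|l a bs IHa IHb] /=.
  by rewrite inE eq_sym => /negbTE->.
rewrite inE mem_cat !negb_or => /and3P[pl pa pb].
move: IHb => /=; rewrite inE negb_or pl pb => /(_ isT)[].
by rewrite (IHa pa) => ->.
Qed.

Section GrowSum.
Variable R : realType.

(** A uniformly random parent label is a uniformly random node: this passes from
    the labelled process to [grow], after which labels can be forgotten. *)
Lemma sum_attach (X : tree -> R) new t : uniq (labels t) ->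
  \sum_(p <- labels t) X (forget_labels (attach p new t)) =
  \sum_(t' <- grow (forget_labels t)) X t'.
Proof.
elim/labelled_graft_ind: t X => [l|l a bs IHa IHb] X.
  by rewrite /= !big_seq1 eqxx.
move=> U; have Ul : uniq (labels (LNode l bs)).
  by move: U; rewrite /= mem_cat negb_or cat_uniq => /andP[/andP[_ ->] /and3P[]].
have Ua : uniq (labels a).
  by move: U; rewrite /= mem_cat negb_or cat_uniq => /andP[_ /and3P[]].
have D p : p \in labels (LNode l bs) -> p \notin labels a.
  move: U; rewrite /= mem_cat negb_or cat_uniq inE.
  move=> /andP[/andP[la _] /and3P[_ /hasPn H _]] /orP[/eqP-> //|]; exact: H.
have -> : forget_labels (LNode l (a :: bs)) =
  graft (forget_labels a) (forget_labels (LNode l bs)) by [].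
rewrite grow_graft big_cat !big_map /= -IHa //.
rewrite -(IHb (fun t => X (graft (forget_labels a) t)) Ul).
rewrite (perm_big (labels a ++ labels (LNode l bs))) /=; last first.
  by rewrite perm_sym -cat1s perm_catCA.
rewrite big_cat; congr (_ + _); apply: eq_big_seq => p pin.
  have pn : p \notin labels (LNode l bs) by apply/negP=> /D; rewrite pin.
  by have := attach_notin new pn; rewrite /= => -[->].
by have := attach_notin new (D p pin); rewrite /graft /= => ->.
Qed.

End GrowSum.

Lemma perm_labels_recursive_tree m (c : choices m) :
  perm_eq (labels (recursive_tree c)) (iota 0 m.+1).
Proof.
elim: m c => [|m IH] c //.
apply/permP => P; rewrite [recursive_tree c]/= count_labels_attach.
have -> : iota 0 m.+2 = iota 0 m.+1 ++ [:: m.+1] by rewrite -(addn1 m.+1) iotaD.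
have /permP E := IH c.1; rewrite !E count_cat count_uniq_mem ?iota_uniq//.
by rewrite mem_iota ltn_ord mul1n /= addn0.
Qed.

Lemma tree_size_recursive_tree m (c : choices m) :
  tree_size (forget_labels (recursive_tree c)) = m.+1.
Proof.
by rewrite -size_labels (perm_size (perm_labels_recursive_tree c)) size_iota.
Qed.

(** * Expectation over random recursive trees *)

Section Mean.
Variable R : realType.
Implicit Types (X Y : tree -> R) (n m : nat).

Lemma card_choices_gt0 m : (0 < #|choices m|)%N.
Proof. by elim: m => [|m IH]; rewrite ?card_unit ?card_prod ?card_ord ?muln_gt0 ?IH. Qed.

Lemma card_choices_neq0 m : #|choices m|%:R != 0 :> R.
Proof. by rewrite pnatr_eq0 -lt0n card_choices_gt0. Qed.

Lemma eq_rrt_mean n X Y : (0 < n)%N ->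
  (forall t, tree_size t = n -> X t = Y t) -> rrt_mean n X = rrt_mean n Y.
Proof.
move=> n0 XY; rewrite /rrt_mean; congr (_ / _); apply: eq_bigr => c _.
by rewrite XY // tree_size_recursive_tree prednK.
Qed.

Lemma rrt_mean_le n X Y : (0 < n)%N ->
  (forall t, tree_size t = n -> X t <= Y t) -> rrt_mean n X <= rrt_mean n Y.
Proof.
move=> n0 XY; rewrite /rrt_mean ler_pM2r ?invr_gt0 ?ltr0n ?card_choices_gt0//.
by apply: ler_sum => c _; rewrite XY // tree_size_recursive_tree prednK.
Qed.

Lemma rrt_mean_cst n (a : R) : rrt_mean n (fun=> a) = a.
Proof.
by rewrite /rrt_mean sumr_const cardT -cardE -[a *+ _]mulr_natr mulfK ?card_choices_neq0.
Qed.

Lemma rrt_mean_sum n I (s : seq I) (X : I -> tree -> R) :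
  rrt_mean n (fun t => \sum_(i <- s) X i t) = \sum_(i <- s) rrt_mean n (X i).
Proof. by rewrite /rrt_mean exchange_big /= mulr_suml. Qed.

Lemma rrt_meanD n X Y :
  rrt_mean n (fun t => X t + Y t) = rrt_mean n X + rrt_mean n Y.
Proof. by rewrite /rrt_mean big_split mulrDl. Qed.

Lemma rrt_meanZ n a X : rrt_mean n (fun t => a * X t) = a * rrt_mean n X.
Proof. by rewrite /rrt_mean -mulr_sumr mulrA. Qed.

Lemma rrt_meanZr n a X : rrt_mean n (fun t => X t * a) = rrt_mean n X * a.
Proof. by rewrite mulrC -rrt_meanZ; congr rrt_mean; apply/funext=> t; rewrite mulrC. Qed.

Lemma rrt_meanB n X Y :
  rrt_mean n (fun t => X t - Y t) = rrt_mean n X - rrt_mean n Y.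
Proof.
rewrite rrt_meanD; congr (_ + _); rewrite -mulN1r -rrt_meanZ.
by congr rrt_mean; apply/funext=> t; rewrite mulN1r.
Qed.

Lemma rrt_mean_ge0 n X : (forall t, 0 <= X t) -> 0 <= rrt_mean n X.
Proof. by move=> X0; rewrite mulr_ge0 ?invr_ge0 ?sumr_ge0. Qed.

Lemma rrt_mean1 X : rrt_mean 1 X = X (Node [::]).
Proof.
rewrite -[RHS](rrt_mean_cst 1); apply: eq_rrt_mean => // -[[|a bs]] //= [].
by case: a => ts /=.
Qed.

Lemma rrt_mean_exchange n m (X : tree -> tree -> R) :
  rrt_mean n (fun a => rrt_mean m (X a)) =
  rrt_mean m (fun b => rrt_mean n (X^~ b)).
Proof. by rewrite {1}/rrt_mean -rrt_mean_sum -rrt_meanZr. Qed.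

Lemma rrt_var_ge0 n X : 0 <= rrt_var n X.
Proof. by apply: rrt_mean_ge0 => t; exact: sqr_ge0. Qed.

Lemma eq_rrt_var n X Y : (0 < n)%N ->
  (forall t, tree_size t = n -> X t = Y t) -> rrt_var n X = rrt_var n Y.
Proof.
move=> n0 XY; rewrite /rrt_var (eq_rrt_mean n0 XY).
by apply: eq_rrt_mean => // t /XY->.
Qed.

Lemma rrt_mean_grow n X : (0 < n)%N ->
  rrt_mean n.+1 X = n%:R^-1 * rrt_mean n (fun t => \sum_(t' <- grow t) X t').
Proof.
case: n => // m _; rewrite /rrt_mean [n in choices n]/= card_prod card_ord natrM invfM.
rewrite mulrA [LHS]mulrC; congr (_ * (_ * _)).
rewrite -(pair_big xpredT xpredT (fun (c : choices m) (p : 'I_m.+1) =>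
  X (forget_labels (recursive_tree ((c, p) : choices m.+1)))))/=.
apply: eq_bigr => c _; have P := perm_labels_recursive_tree c.
rewrite -(sum_attach _ m.+1) ?(perm_uniq P) ?iota_uniq// (perm_big _ P).
by rewrite -[iota 0 m.+1]/(index_iota 0 m.+1) big_mkord.
Qed.

(** Cutting the edge between the first two nodes leaves two pieces whose sizes
    are uniform and which, given the sizes, are independent random recursive
    trees.  The reason is that the step from [n] to [n + 1] nodes preserves this
    description: pieces of sizes [u] and [n - u] receive the new leaf with weights
    [u] and [n - u], so the sizes [v] and [n + 1 - v] collect weight
    [(v - 1) + (n - v) = n - 1], which is independent of [v]. *)
Theorem rrt_mean_graft n X : (0 < n)%N ->
  rrt_mean n.+1 X = n%:R^-1 * \sum_(1 <= u < n.+1)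
    rrt_mean u (fun a => rrt_mean (n.+1 - u) (fun b => X (graft a b))).
Proof.
elim: n X => // -[_|n IH] X _.
  rewrite rrt_mean_grow // rrt_mean1 /= !big_nat1 big_seq1 rrt_mean1.
  by rewrite subn1 rrt_mean1.
rewrite rrt_mean_grow // IH //.
pose J u := rrt_mean u (fun a => rrt_mean (n.+3 - u) (fun b => X (graft a b))).
rewrite (eq_big_nat _ _ (F2 := fun u => u%:R * J u.+1 + (n.+2 - u)%:R * J u)); last first.
  move=> u /andP[u0 un].
  rewrite -[RHS]/(_ * rrt_mean _ _ + _ * rrt_mean _ _) rrt_mean_exchange.
  rewrite subSS rrt_mean_grow // mulVKf; last by rewrite pnatr_eq0 -lt0n.
  rewrite [X in _ + _ * X](eq_rrt_mean (Y := fun a => (n.+2 - u)%:R^-1 *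
     rrt_mean (n.+2 - u) (fun b => \sum_(b' <- grow b) X (graft a b')))) //; last first.
    by move=> a _; rewrite (subSn (ltnW un)) rrt_mean_grow // subn_gt0.
  rewrite rrt_meanZ mulVKf; last by rewrite pnatr_eq0 subn_eq0 -ltnNge.
  rewrite rrt_mean_exchange -rrt_meanD; apply: eq_rrt_mean => // a _.
  rewrite -rrt_mean_sum -rrt_meanD; congr rrt_mean; apply/funext => b.
  by rewrite grow_graft big_cat !big_map.
rewrite big_split /=.
have -> : \sum_(1 <= u < n.+2) u%:R * J u.+1 = \sum_(1 <= u < n.+3) u.-1%:R * J u.
  by rewrite [RHS]big_ltn // mul0r add0r big_add1.
have -> : \sum_(1 <= u < n.+2) (n.+2 - u)%:R * J u =
    \sum_(1 <= u < n.+3) (n.+2 - u)%:R * J u.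
  by rewrite [RHS]big_nat_recr //= subnn mul0r addr0.
rewrite -big_split /= (eq_big_nat _ _ (F2 := fun u => n.+1%:R * J u)); last first.
  by move=> u /andP[u0 un]; rewrite -mulrDl -natrD; congr (_%:R * _); lia.
by rewrite -mulr_sumr mulKf // pnatr_eq0.
Qed.

(** Every ordered tree with [n] nodes has positive probability; stated without
    the probability itself, the induction along [graft] is immediate. *)
Lemma rrt_mean_eq0 X t : (forall s, 0 <= X s) ->
  rrt_mean (tree_size t) X = 0 -> X t = 0.
Proof.
elim/graft_ind: t X => [|a b IHa IHb] X X0.
  by rewrite /= rrt_mean1.
have := tree_size_gt0 a; have := tree_size_gt0 b; rewrite tree_size_graft.
case E : (tree_size b) => [//|m] _ a0; rewrite addnS rrt_mean_graft ?addn_gt0 ?a0//.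
set M := (X in _ * X = 0) => /eqP.
rewrite mulf_eq0 invr_eq0 pnatr_eq0 addn_eq0 eqn0Ngt a0 /= /M.
rewrite psumr_eq0; last by move=> u _; do 2 apply: rrt_mean_ge0 => ?.
move=> /allP/(_ (tree_size a)); rewrite mem_index_iota a0 ltnS leq_addr => /(_ isT)/eqP.
move=> H; apply: (IHb (fun b => X (graft a b))) => //.
rewrite -[RHS](IHa _ _ H); last by move=> s; apply: rrt_mean_ge0 => ?.
by rewrite E -addnS addKn.
Qed.

Lemma rrt_var_eq0P n X : (0 < n)%N -> rrt_var n X = 0 ->
  forall t, tree_size t = n -> X t = rrt_mean n X.
Proof.
move=> n0 V t tn; apply/eqP; rewrite -subr_eq0 -sqrf_eq0; apply/eqP.
apply: (rrt_mean_eq0 (X := fun t => (X t - rrt_mean n X) ^+ 2)).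
  by move=> s; exact: sqr_ge0.
by rewrite tn.
Qed.

Lemma rrt_var_add_le n (X Y : tree -> R) : (0 < n)%N ->
  rrt_var n (fun t => X t + Y t) <= 2 * rrt_var n X + 2 * rrt_var n Y.
Proof.
move=> n0; rewrite /rrt_var -!rrt_meanZ -rrt_meanD [in leLHS]rrt_meanD.
apply: rrt_mean_le => // t _; have := sqr_ge0 ((X t - rrt_mean n X) - (Y t - rrt_mean n Y)).
by move: (rrt_mean n X) (rrt_mean n Y) (X t) (Y t) => a b x y; nra.
Qed.

End Mean.

(** * Principal subtrees *)

Section PrincipalSubtrees.
Variable R : realType.
Implicit Types (X Y : tree -> R) (n m : nat) (x : nat -> R).

Lemma split_ind (P : nat -> Prop) :
  P 1%N -> (forall n, (0 < n)%N -> (forall m, (0 < m <= n)%N -> P m) -> P n.+1) ->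
  forall n, (0 < n)%N -> P n.
Proof.
move=> P1 PS n; elim/ltn_ind: n => -[|[|n]] // IH _; apply: PS => // m /andP[m0 mn].
exact: IH.
Qed.

Lemma sum_nat_rev n x :
  \sum_(1 <= u < n.+1) x (n.+1 - u)%N = \sum_(1 <= u < n.+1) x u.
Proof.
rewrite big_nat_rev; apply: eq_big_nat => u /andP[u0 un]; congr x; lia.
Qed.

Lemma sum_nat_harmonic n x :
  \sum_(1 <= u < n.+1) (x u + \sum_(1 <= m < u) x m / m%:R) =
  n%:R * \sum_(1 <= m < n.+1) x m / m%:R.
Proof.
elim: n => [|n IH]; first by rewrite !big_geq ?mulr0.
rewrite big_nat_recr //= IH [in RHS]big_nat_recr //= mulrDr.
rewrite mulrCA mulfV ?pnatr_eq0// -natr1.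
ring.
Qed.

(** The expected number of principal subtrees with [m] nodes is [1 / m], for
    every [m < n]: only the first principal subtree and those of the other piece
    contribute, and [sum_nat_harmonic] solves the resulting recursion. *)
Lemma rrt_mean_children n X : (0 < n)%N ->
  rrt_mean n (fun t => \sum_(s <- children t) X s) =
  \sum_(1 <= m < n) rrt_mean m X / m%:R.
Proof.
move: n; apply: split_ind => [|n n0 IH].
  by rewrite rrt_mean1 big_nil big_geq.
rewrite rrt_mean_graft //.
rewrite (eq_big_nat _ _ (F2 := fun u => rrt_mean u X +
   \sum_(1 <= m < n.+1 - u) rrt_mean m X / m%:R)); last first.
  move=> u /andP[u0 un]; rewrite -IH; last by lia.
  under eq_fun do under eq_fun do rewrite big_cons.
  under eq_fun do rewrite rrt_meanD rrt_mean_cst.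
  by rewrite rrt_meanD rrt_mean_cst.
rewrite big_split /= (sum_nat_rev n (fun u => \sum_(1 <= m < u) rrt_mean m X / m%:R)).
by rewrite -big_split /= sum_nat_harmonic mulKf // pnatr_eq0 -lt0n.
Qed.

Definition centered X t := X t - rrt_mean (tree_size t) X.

Lemma rrt_mean_centered n X : (0 < n)%N -> rrt_mean n (centered X) = 0.
Proof.
move=> n0; rewrite -[RHS](subrr (rrt_mean n X)).
rewrite -[in X in _ - X](rrt_mean_cst n (rrt_mean n X)) -rrt_meanB.
by apply: eq_rrt_mean => // t; rewrite /centered => ->.
Qed.

Lemma rrt_mean_centered_sqr n X : (0 < n)%N ->
  rrt_mean n (fun t => centered X t ^+ 2) = rrt_var n X.
Proof. by move=> n0; apply: eq_rrt_mean => // t; rewrite /centered => ->. Qed.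

(** Given the sizes of the principal subtrees, each of these is a random recursive
    tree, so the centered sum has conditional mean zero; the weight [theta] tests
    the conditioning. *)
Lemma rrt_mean_forest_centered n X (theta : seq nat -> R) : (0 < n)%N ->
  rrt_mean n (fun t => theta (principal_sizes t) *
                       \sum_(s <- children t) centered X s) = 0.
Proof.
move=> n0; move: n n0 theta; apply: split_ind => [|n n0 IH] theta.
  by rewrite rrt_mean1 big_nil mulr0.
rewrite rrt_mean_graft // big_nat big1 ?mulr0// => u /andP[u0 un].
rewrite (eq_rrt_mean (Y := fun a => centered X a *
  rrt_mean (n.+1 - u) (fun b => theta (u :: principal_sizes b)))) //; last first.
  move=> a sa; transitivity (rrt_mean (n.+1 - u) (fun b =>
      centered X a * theta (u :: principal_sizes b) +
      theta (u :: principal_sizes b) * \sum_(s <- children b) centered X s)).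
    congr rrt_mean; apply/funext => b.
    by rewrite big_cons mulrDr /principal_sizes /= sa [centered X a * _]mulrC.
  by rewrite rrt_meanD rrt_meanZ (IH (n.+1 - u)%N _ (fun s => theta (u :: s))) ?addr0//; lia.
by rewrite rrt_meanZr rrt_mean_centered // mul0r.
Qed.

(** The cross terms vanish because, given their sizes, the principal subtrees
    are independent. *)
Lemma rrt_mean_sqr_forest_centered n X : (0 < n)%N ->
  rrt_mean n (fun t => (\sum_(s <- children t) centered X s) ^+ 2) =
  rrt_mean n (fun t => \sum_(s <- children t) (centered X s) ^+ 2).
Proof.
move: n; apply: split_ind => [|n n0 IH].
  by rewrite !rrt_mean1 !big_nil expr0n.
rewrite !rrt_mean_graft //; congr (_ * _); apply: eq_big_nat => u /andP[u0 un].
congr rrt_mean; apply/funext => a.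
have nu : (0 < n.+1 - u <= n)%N by lia.
transitivity (rrt_mean (n.+1 - u) (fun b => centered X a ^+ 2 +
      centered X a *+ 2 * (\sum_(s <- children b) centered X s) +
      (\sum_(s <- children b) centered X s) ^+ 2)).
  congr rrt_mean; apply/funext => b.
  by rewrite big_cons sqrrD mulrnAl.
rewrite !rrt_meanD IH //.
have /= -> := rrt_mean_forest_centered (n := n.+1 - u) X
  (fun=> centered X a *+ 2); last by case/andP: nu.
rewrite addr0 rrt_mean_cst -[centered X a ^+ 2 in LHS](rrt_mean_cst (n.+1 - u)).
by rewrite -rrt_meanD; congr rrt_mean; apply/funext => b; rewrite big_cons.
Qed.

Lemma forest_centered_sum X t :
  \sum_(s <- children t) X s = \sum_(m <- principal_sizes t) rrt_mean m X +
    \sum_(s <- children t) centered X s.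
Proof.
rewrite /principal_sizes big_map -big_split /=; apply: eq_bigr => s _.
by rewrite /centered subrKC.
Qed.

Lemma rrt_mean_forest n X (theta : seq nat -> R) : (0 < n)%N ->
  rrt_mean n (fun t => theta (principal_sizes t) + \sum_(s <- children t) X s) =
  rrt_mean n (fun t => theta (principal_sizes t) +
                       \sum_(m <- principal_sizes t) rrt_mean m X).
Proof.
move=> n0; under eq_fun do rewrite forest_centered_sum addrA.
have := rrt_mean_forest_centered X (fun=> 1) n0; under eq_fun do rewrite mul1r.
by move=> H; rewrite [LHS]rrt_meanD H addr0.
Qed.

(** Law of total variance, conditioning on the sizes of the principal subtrees:
    [rrt_mean_forest_centered] says that the conditional mean is the first
    variable on the right, and the mean conditional variance is evaluated by
    [rrt_mean_children]. *)
Theorem rrt_var_forest n X (theta : seq nat -> R) : (0 < n)%N ->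
  rrt_var n (fun t => theta (principal_sizes t) + \sum_(s <- children t) X s) =
  rrt_var n (fun t => theta (principal_sizes t) +
                       \sum_(m <- principal_sizes t) rrt_mean m X) +
  \sum_(1 <= m < n) rrt_var m X / m%:R.
Proof.
move=> n0; rewrite /rrt_var rrt_mean_forest //; set mu := rrt_mean n (fun t =>
  theta (principal_sizes t) + \sum_(m <- principal_sizes t) rrt_mean m X).
transitivity (rrt_mean n (fun t =>
   (theta (principal_sizes t) + \sum_(m <- principal_sizes t) rrt_mean m X - mu) ^+ 2 +
   ((theta (principal_sizes t) + \sum_(m <- principal_sizes t) rrt_mean m X - mu) *+ 2 *
     \sum_(s <- children t) centered X s) +
   (\sum_(s <- children t) centered X s) ^+ 2)).
  congr rrt_mean; apply/funext => t.
  rewrite forest_centered_sum addrA -[LHS]/((_ + _ - mu) ^+ 2).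
  by rewrite addrAC sqrrD mulrnAl.
rewrite !rrt_meanD rrt_mean_sqr_forest_centered //.
have /= -> := rrt_mean_forest_centered X
  (fun s => (theta s + \sum_(m <- s) rrt_mean m X - mu) *+ 2) n0.
rewrite addr0 rrt_mean_children //; congr (_ + _); apply: eq_big_nat => m /andP[m0 _].
by rewrite rrt_mean_centered_sqr.
Qed.

Lemma additive_functionalE f t : additive_functional f t =
  f t + \sum_(s <- children t) additive_functional f s :> R.
Proof. by case: t => ts; rewrite /additive_functional big_cons big_flatten big_map. Qed.

End PrincipalSubtrees.

(** * Variance of sums over the sizes of the principal subtrees *)

Section HarmonicSums.
Variables (R : realType) (x : nat -> R).
Implicit Types (n u k : nat).

(** By [rrt_mean_children] this is the expectation of the sum of [x] over the
    sizes of the principal subtrees of a random tree with [n] nodes. *)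
Definition harmonic_sum n := \sum_(1 <= m < n) x m / m%:R.

(** What the root adds: if [x k] is the mean of an additive functional on trees
    with [k] nodes, [excess k] is the mean of its toll function; if [x k] is the
    variance, [excess k] is the variance that does not come from the principal
    subtrees. *)
Definition excess n := x n - harmonic_sum n.

Definition slope n := harmonic_sum n / n%:R.

(** The next harmonic sum is [(1 + 1 / n) * harmonic_sum n + excess n / n];
    division by [n + 1] turns this recursion into a telescoping one. *)
Lemma slopeS n : (0 < n)%N ->
  slope n.+1 = slope n + excess n / (n%:R * n.+1%:R).
Proof.
move=> n0; rewrite /slope /excess /harmonic_sum big_nat_recr //=.
have nz : n%:R != 0 :> R by rewrite pnatr_eq0 -lt0n.
have nz1 : n%:R + 1 != 0 :> R by rewrite natr1 pnatr_eq0.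
by rewrite -natr1; field; rewrite nz nz1.
Qed.

Lemma slopeE n : (0 < n)%N ->
  slope n = \sum_(1 <= k < n) excess k / (k%:R * k.+1%:R).
Proof.
elim: n => // -[|n] IH _; last by rewrite slopeS // IH // [RHS]big_nat_recr.
by rewrite /slope /harmonic_sum !big_geq ?mul0r.
Qed.

(** Cauchy-Schwarz for the telescoping sum of [slopeS], with the weights
    [1 / (j (j + 1))], which add up to [1 / u - 1 / (u + k)]. *)
Lemma slope_diff_sqr u k : (0 < u)%N ->
  (slope (u + k)%N - slope u) ^+ 2 <= (u%:R^-1 - (u + k)%:R^-1) *
    \sum_(u <= j < u + k) excess j ^+ 2 / (j%:R * j.+1%:R).
Proof.
move=> u0; elim: k => [|k IH]; first by rewrite addn0 !subrr mul0r expr0n.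
rewrite addnS slopeS ?addn_gt0 ?u0// big_nat_recr ?leq_addr//=.
move: IH; set v := (u + k)%N; set p := \sum_(_ <= _ < _) _.
have v0 : 0 < v%:R :> R by rewrite ltr0n addn_gt0 u0.
have uv : v%:R^-1 <= u%:R^-1 :> R.
  by rewrite lef_pV2 ?posrE ?ltr0n ?ler_nat ?leq_addr ?addn_gt0 ?u0.
have p0 : 0 <= p by apply: sumr_ge0 => j _; rewrite divr_ge0 ?sqr_ge0 ?mulr_ge0.
have b0 : 0 < (v%:R * v.+1%:R)^-1 :> R by rewrite invr_gt0 mulr_gt0 // ltr0n.
have -> : u%:R^-1 - v.+1%:R^-1 = (u%:R^-1 - v%:R^-1) + (v%:R * v.+1%:R)^-1 :> R.
  have vz : v%:R != 0 :> R by rewrite gt_eqF.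
  have vz1 : v%:R + 1 != 0 :> R by rewrite natr1 pnatr_eq0.
  have uz : u%:R != 0 :> R by rewrite pnatr_eq0 -lt0n.
  by rewrite -natr1; field; rewrite vz vz1 uz.
have : 0 <= u%:R^-1 - v%:R^-1 :> R by rewrite subr_ge0.
move: (u%:R^-1 - v%:R^-1) (slope v) (slope u) (excess v) p0 b0.
move: p (_^-1) => p b a s s' m p0 b0 a0 IH.
(* The inequality of means for [a * m ^ 2] and [p]. *)
have K : 2 * (s - s') * m <= a * m ^+ 2 + p.
  have [a1|a1] := eqVneq a 0.
    move: IH; rewrite a1 mul0r => IH.
    have /eqP-> : s - s' == 0 by rewrite -sqrf_eq0 eq_le IH sqr_ge0.
    lra.
  have a2 : 0 < a by rewrite lt_def a1.
  rewrite -(ler_pM2l a2); have := sqr_ge0 (a * m - (s - s')); nra.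
rewrite -subr_ge0 in K.
rewrite -subr_ge0; have -> : (a + b) * (p + m ^+ 2 * b) - (s + m * b - s') ^+ 2 =
  (a * p - (s - s') ^+ 2) + b * (a * m ^+ 2 + p - 2 * (s - s') * m) by ring.
by rewrite addr_ge0 ?subr_ge0// mulr_ge0 // ltW.
Qed.

Lemma sum_nat_weighted_tails n (r : nat -> R) :
  \sum_(1 <= u < n) u%:R * (\sum_(u <= j < n) r j) =
  2^-1 * \sum_(1 <= j < n) r j * (j%:R * j.+1%:R).
Proof.
case: n => [|n]; first by rewrite !big_geq ?mulr0.
elim: n => [|n IH]; first by rewrite !big_geq ?mulr0.
rewrite [in RHS]big_nat_recr //= mulrDr -IH.
rewrite (eq_big_nat _ _ (F2 := fun u => u%:R * (\sum_(u <= j < n.+1) r j) +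
  u%:R * r n.+1)); last first.
  by move=> u /andP[u0 un]; rewrite big_nat_recr //= mulrDr.
rewrite big_split /= big_nat_recr //= [\sum_(n.+1 <= j < n.+1) _]big_geq // mulr0 addr0.
congr (_ + _); rewrite -mulr_suml mulrCA mulrC; congr (_ * _).
elim: (n.+1) => [|k IHk]; first by rewrite big_geq // mul0r mulr0.
by rewrite big_nat_recr //= IHk -!natr1; field.
Qed.

Lemma sum_slope_diff_sqr n :
  \sum_(1 <= u < n) (u%:R * (slope u - slope n)) ^+ 2 <=
  2^-1 * \sum_(1 <= j < n) excess j ^+ 2.
Proof.
have -> : \sum_(1 <= j < n) excess j ^+ 2 = \sum_(1 <= j < n)
    (excess j ^+ 2 / (j%:R * j.+1%:R)) * (j%:R * j.+1%:R).
  apply: eq_big_nat => j /andP[j0 _]; rewrite divfK // mulf_neq0 ?pnatr_eq0//.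
  by rewrite -lt0n.
rewrite -sum_nat_weighted_tails; apply: ler_sum_nat => u /andP[u0 un].
have := slope_diff_sqr (n - u) u0; rewrite subnKC ?(ltnW un)// => H.
have uR : 0 < u%:R :> R by rewrite ltr0n.
rewrite exprMn expr2 -mulrA ler_pM2l // -sqrrN opprB.
apply: le_trans (ler_wpM2l (ltW uR) H) _.
rewrite mulrA ler_piMl //; last by rewrite mulrBr mulfV ?gt_eqF// gerBl divr_ge0.
by apply: sumr_ge0 => j _; rewrite divr_ge0 ?sqr_ge0 ?mulr_ge0.
Qed.

(** The left side is, up to the factor [n], the mean square of the change in
    conditional expectation caused by revealing the size [u] of the first
    principal subtree.  Writing [harmonic_sum k] as [k * slope k] makes the linear
    parts cancel, which leaves [excess u] and two slope differences. *)
Lemma sum_split_defect_sqr n :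
  \sum_(1 <= u < n.+1) (x u + harmonic_sum (n.+1 - u) - harmonic_sum n.+1) ^+ 2
  <= 6 * \sum_(1 <= j < n.+1) excess j ^+ 2.
Proof.
have S := sum_slope_diff_sqr n.+1.
apply: (@le_trans _ _ (3 * \sum_(1 <= u < n.+1) (excess u ^+ 2 +
   (u%:R * (slope u - slope n.+1)) ^+ 2 +
   ((n.+1 - u)%:R * (slope (n.+1 - u) - slope n.+1)) ^+ 2))); last first.
  rewrite !big_split /= (sum_nat_rev n (fun v => (v%:R * (slope v - slope n.+1)) ^+ 2)).
  move: S; set A := \sum_(_ <= _ < _) _; set B := \sum_(_ <= _ < _) _; lra.
rewrite mulr_sumr; apply: ler_sum_nat => u /andP[u0 un].
have E k : (0 < k)%N -> harmonic_sum k = k%:R * slope k.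
  by move=> k0; rewrite /slope mulrCA mulfV ?mulr1// pnatr_eq0 -lt0n.
have -> : x u + harmonic_sum (n.+1 - u) - harmonic_sum n.+1 =
  excess u + u%:R * (slope u - slope n.+1) +
  (n.+1 - u)%:R * (slope (n.+1 - u) - slope n.+1).
  rewrite /excess !E //; last by rewrite subn_gt0.
  by rewrite (natrB _ (ltnW un)); ring.
set b := u%:R * _; set c := (n.+1 - u)%:R * _; set a := excess u.
rewrite -subr_ge0; have -> : 3 * (a ^+ 2 + b ^+ 2 + c ^+ 2) - (a + b + c) ^+ 2 =
  (a - b) ^+ 2 + (b - c) ^+ 2 + (a - c) ^+ 2 by ring.
by rewrite !addr_ge0 ?sqr_ge0.
Qed.

Lemma rrt_mean_principal_sizes n : (0 < n)%N ->
  rrt_mean n (fun t => \sum_(m <- principal_sizes t) x m) = harmonic_sum n.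
Proof.
move=> n0; under eq_fun do rewrite /principal_sizes big_map.
rewrite rrt_mean_children //; apply: eq_big_nat => m /andP[m0 _]; congr (_ / _).
by rewrite -[RHS](rrt_mean_cst m); apply: eq_rrt_mean => // t ->.
Qed.

(** An inequality of Turan-Kubilius type.  By the recursion of [rrt_mean_graft]
    the variance of size [n + 1] is an average of earlier ones plus the defect
    bounded in [sum_split_defect_sqr]; [sum_nat_harmonic] says that the right-hand
    side solves the same recursion with that bound. *)
Theorem rrt_var_principal_sizes n : (0 < n)%N ->
  rrt_var n (fun t => \sum_(m <- principal_sizes t) x m) <=
  6 * \sum_(1 <= j < n) excess j ^+ 2 / j%:R.
Proof.
set Y := fun t : tree => _.
move: n; apply: split_ind => [|n n0 IH].
  by rewrite /rrt_var rrt_mean1 rrt_mean_principal_sizes // /harmonic_sum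
             /Y /= !big_nil subrr expr0n mulr0.
have -> : rrt_var n.+1 Y = n%:R^-1 * \sum_(1 <= u < n.+1)
   ((x u + harmonic_sum (n.+1 - u) - harmonic_sum n.+1) ^+ 2 + rrt_var (n.+1 - u) Y).
  rewrite /rrt_var !rrt_mean_principal_sizes // rrt_mean_graft //.
  congr (_ * _); apply: eq_big_nat => u /andP[u0 un].
  have v0 : (0 < n.+1 - u)%N by rewrite subn_gt0.
  rewrite rrt_mean_principal_sizes // -[RHS](rrt_mean_cst u).
  apply: eq_rrt_mean => // a sa; set d := x u + _ - _.
  transitivity (rrt_mean (n.+1 - u) (fun b => d ^+ 2 +
      d *+ 2 * (Y b - harmonic_sum (n.+1 - u)) + (Y b - harmonic_sum (n.+1 - u)) ^+ 2)).
    congr rrt_mean; apply/funext => b.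
    rewrite /Y /principal_sizes /= big_cons sa /d -/(principal_sizes b).
    set z := \sum_(_ <- _) _; ring.
  by rewrite !rrt_meanD rrt_meanZ rrt_meanB !rrt_mean_cst rrt_mean_principal_sizes //
             subrr mulr0 addr0.
rewrite mulrC ler_pdivrMr ?ltr0n// -mulrA [_ * n%:R]mulrC.
rewrite -(sum_nat_harmonic n (fun j => excess j ^+ 2)) !big_split /= mulrDr.
rewrite lerD ?sum_split_defect_sqr// (sum_nat_rev n (fun v => rrt_var v Y)) mulr_sumr.
by apply: ler_sum_nat => u /IH.
Qed.

End HarmonicSums.
(** * Series *)

Section Series.
Variable R : realType.
Implicit Types (u : nat -> R) (n k : nat).

Lemma nneseries_bounded u : (forall k, 0 <= u k) ->
  (\sum_(1 <= k <oo) (u k)%:E < +oo)%E ->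
  exists C, forall n, \sum_(1 <= k < n) u k <= C.
Proof.
move=> u0 fin.
have ge0 : (0 <= \sum_(1 <= k <oo) (u k)%:E)%E.
  by apply: nneseries_ge0 => k _ _; rewrite lee_fin.
exists (fine (\sum_(1 <= k <oo) (u k)%:E)%E) => n.
rewrite -lee_fin fineK ?ge0_fin_numE// -sumEFin.
by apply: nneseries_lim_ge => k _ _; rewrite lee_fin.
Qed.

Lemma eseries_EFin u (l : R) : \sum_(1 <= k < n) u k @[n --> \oo] --> l ->
  (\sum_(1 <= k <oo) (u k)%:E = l%:E)%E.
Proof.
move=> ul; apply: cvg_lim => //; under eq_fun do rewrite sumEFin.
by apply: cvg_EFin => //; exact: nearW.
Qed.

Lemma bounded_nnseries_cvg u C : (forall k, 0 <= u k) ->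
  (forall n, \sum_(1 <= k < n) u k <= C) ->
  cvgn (fun n => \sum_(1 <= k < n) u k).
Proof.
move=> u0 uC; apply: nondecreasing_is_cvgn; last by exists C => _ [n _ <-].
apply/nondecreasing_seqP => -[|n]; first by rewrite !big_geq.
by rewrite [leRHS]big_nat_recr //= lerDl.
Qed.

(** By [slopeE] the sum on the left is the corresponding sum for [q] minus
    [slope q n], which is nonnegative. *)
Lemma sum_harmonic_sum_le (q : nat -> R) C n : (forall k, 0 <= q k) ->
  (forall n, \sum_(1 <= k < n) q k / k%:R ^+ 2 <= C) ->
  \sum_(1 <= k < n) harmonic_sum q k / (k%:R * k.+1%:R) <= C.
Proof.
move=> q0 qC; have [n0|n0] := leqP n 0.
  by have := qC 0; rewrite !big_geq //; lia.
have H0 k : 0 <= harmonic_sum q k by apply: sumr_ge0 => j _; rewrite divr_ge0.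
have := slopeE q n0; under eq_bigr do rewrite mulrBl; rewrite sumrB => E.
apply: le_trans (qC n); apply: (@le_trans _ _ (\sum_(1 <= k < n) q k / (k%:R * k.+1%:R))).
  by rewrite -subr_ge0 -E divr_ge0.
apply: ler_sum_nat => k /andP[k0 _]; rewrite ler_wpM2l // lef_pV2 ?posrE; first last.
- by rewrite exprn_gt0 ?ltr0n.
- by rewrite mulr_gt0 ?ltr0n.
by rewrite expr2 ler_wpM2l // ler_nat.
Qed.

(** Kronecker's lemma: [slope q n] is the partial sum of the series minus the mean
    of all partial sums up to it, and by Cesaro both have the same limit. *)
Lemma kronecker (q : nat -> R) (l : R) :
  \sum_(1 <= k < n) q k / k%:R ^+ 2 @[n --> \oo] --> l ->
  slope q n @[n --> \oo] --> (0 : R).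
Proof.
set r := fun n => _ => rl; rewrite -cvg_shiftS /=.
have rl1 : r n.+1 @[n --> \oo] --> l by rewrite (cvg_shiftS r).
pose avg := arithmetic_mean (fun n => r n.+1).
suff -> : (fun n => slope q n.+1) = (fun n => r n.+1 - avg n).
  by have := cvgB rl1 (cesaro rl1); rewrite subrr; exact.
apply/funext => n; rewrite /avg /arithmetic_mean /slope /series /= mulrC.
have nz : n.+1%:R != 0 :> R by rewrite pnatr_eq0.
apply: (mulfI nz); rewrite mulrBr !mulVKf //.
elim: n {nz} => [|n IH]; first by rewrite big_nat1 /harmonic_sum /r !big_geq // mulr0 subrr.
rewrite /harmonic_sum big_nat_recr //= -/(harmonic_sum q n.+1) IH.
rewrite [\sum_(0 <= k < n.+2) _]big_nat_recr //=.
have -> : r n.+2 = r n.+1 + q n.+1 / n.+1%:R ^+ 2 by rewrite /r big_nat_recr.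
have nz : n%:R + 1 != 0 :> R by rewrite natr1 pnatr_eq0.
by rewrite -!natr1; field.
Qed.

(** Since [v k / k] is bounded by some [M], [v k / k ^ 2] is at most
    [sqrt M * sqrt (v k) / k ^ (3 / 2)]. *)
Lemma sqrt_series_bounded (v : nat -> R) : (forall k, 0 <= v k) ->
  v k / k%:R @[k --> \oo] --> (0 : R) ->
  (\sum_(1 <= k <oo) (Num.sqrt (v k) / (k%:R `^ (3 / 2)))%:E < +oo)%E ->
  exists C, forall n, \sum_(1 <= k < n) v k / k%:R ^+ 2 <= C.
Proof.
move=> v0 vk; have w0 k : 0 <= Num.sqrt (v k) / (k%:R `^ (3 / 2)).
  by rewrite divr_ge0 ?sqrtr_ge0 ?powR_ge0.
move=> /(nneseries_bounded w0)[C HC].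
have [M [_ HM]] := cvg_seq_bounded (cvgP _ vk).
have {}HM k : v k / k%:R <= `|M| + 1.
  have /HM/(_ k I) : M < `|M| + 1 by rewrite (le_lt_trans (ler_norm M)) ?ltrDl.
  by apply: le_trans; exact: ler_norm.
exists (Num.sqrt (`|M| + 1) * C) => n.
apply: le_trans (ler_wpM2l (sqrtr_ge0 _) (HC n)).
rewrite mulr_sumr; apply: ler_sum_nat => k /andP[k0 _].
have kR : 0 < k%:R :> R by rewrite ltr0n.
have -> : k%:R ^+ 2 = k%:R `^ (3 / 2) * Num.sqrt k%:R :> R.
  rewrite -powR12_sqrt ?ler0n// -powRD; last by rewrite (gt_eqF kR) implybT.
  rewrite -powR_mulrn ?ler0n//; by congr (_ `^ _); field.
rewrite invfM mulrA mulrAC mulrA; rewrite ler_wpM2r ?invr_ge0 ?powR_ge0//.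
rewrite -{1}(sqr_sqrtr (v0 k)) expr2 -mulrA [leRHS]mulrC ler_wpM2l ?sqrtr_ge0//.
by rewrite -sqrtrV ?ler0n// -sqrtrM // ler_wsqrtr.
Qed.

End Series.

(** * Additive functionals whose toll depends on sizes *)

Section SizeFunctional.
Variables (R : realType) (f : tree -> R) (g : nat -> nat -> seq nat -> R).
Hypothesis hg : forall t : tree,
  f t = g (tree_size t) (root_degree t) (principal_sizes t).
Let F := additive_functional f.
Let V n := rrt_var n F.
Let mu k := rrt_mean k f.

Lemma excess_nu k : (0 < k)%N -> excess (nu f) k = mu k.
Proof.
move=> k0; rewrite /excess /harmonic_sum -rrt_mean_children //.
rewrite /nu -rrt_meanB; congr rrt_mean; apply/funext => t.
by rewrite additive_functionalE addrK.
Qed.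

Let toll k (s : seq nat) := g k (size s) s.

Lemma psi_variableE k t : psi_variable f g k t =
  toll k (principal_sizes t) + \sum_(m <- principal_sizes t) rrt_mean m F.
Proof. by rewrite /psi_variable /toll /principal_sizes size_map. Qed.

Lemma toll_eq k t : tree_size t = k -> f t = toll k (principal_sizes t).
Proof. by rewrite hg /toll /principal_sizes size_map => ->. Qed.

Lemma additive_toll k t : tree_size t = k ->
  F t = toll k (principal_sizes t) + \sum_(s <- children t) F s.
Proof. by move=> tk; rewrite -toll_eq // /F additive_functionalE. Qed.

Lemma rrt_mean_psi_variable k : (0 < k)%N -> rrt_mean k (psi_variable f g k) = nu f k.
Proof.
move=> k0; rewrite /nu (eq_rrt_mean k0 (@additive_toll k)) rrt_mean_forest //.
by congr rrt_mean; apply/funext => t; rewrite psi_variableE.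
Qed.

(** The law of total variance [rrt_var_forest], read as a recursion for [V]. *)
Lemma psi_excess k : (0 < k)%N -> psi f g k = excess V k.
Proof.
move=> k0; rewrite /excess /harmonic_sum {1}/V (eq_rrt_var k0 (@additive_toll k)).
rewrite rrt_var_forest // addrK /psi; congr rrt_var.
by apply/funext => t; rewrite psi_variableE.
Qed.

(** The variable behind [psi] is the sum of the toll and of the [nu] over the
    principal sizes; the second part is controlled by the means of the toll, since
    these are the [excess] of [nu]. *)
Lemma psi_le k : (0 < k)%N ->
  psi f g k <= 2 * rrt_var k f + 12 * harmonic_sum (fun j => mu j ^+ 2) k.
Proof.
move=> k0; apply: le_trans
  (_ : 2 * rrt_var k f +
       2 * rrt_var k (fun t => \sum_(m <- principal_sizes t) nu f m) <= _).
  apply: le_trans (rrt_var_add_le _ _ k0).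
  rewrite /psi (eq_rrt_var (X := psi_variable f g k)
    (Y := fun t => f t + \sum_(m <- principal_sizes t) nu f m)) //.
  by move=> t tk; rewrite psi_variableE -toll_eq.
rewrite lerD2l; have := rrt_var_principal_sizes (nu f) k0.
rewrite (eq_big_nat _ _ (F2 := fun j => mu j ^+ 2 / j%:R)); last first.
  by move=> j /andP[j0 _]; rewrite excess_nu.
by rewrite -/(harmonic_sum (fun j => mu j ^+ 2) k); lra.
Qed.

Lemma psi_ge0 k : 0 <= psi f g k.
Proof. exact: rrt_var_ge0. Qed.

Definition psi_sum n := \sum_(1 <= k < n) (k%:R * k.+1%:R)^-1 * psi f g k.

(** The recursion [psi_excess], solved: dividing by [n] makes it telescope. *)
Lemma var_additiveE n : V n / n%:R = psi f g n / n%:R + psi_sum n.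
Proof.
case: n => [|n]; first by rewrite invr0 !mulr0 /psi_sum big_geq ?addr0.
have -> : psi_sum n.+1 = slope V n.+1.
  rewrite slopeE //; apply: eq_big_nat => k /andP[k0 _].
  by rewrite psi_excess // mulrC.
by rewrite psi_excess // -mulrDl /excess subrK.
Qed.

Lemma var_eq0_psi : (forall n, (0 < n)%N -> V n = 0) <->
  (forall n, (0 < n)%N -> psi f g n = 0).
Proof.
split=> H n n0.
  rewrite psi_excess // /excess H // /harmonic_sum big_nat big1 ?subrr// => k /andP[k0 _].
  by rewrite H // mul0r.
have : V n / n%:R = 0.
  rewrite var_additiveE H // mul0r add0r /psi_sum big_nat big1// => k /andP[k0 _].
  by rewrite H // mulr0.
by move=> /eqP; rewrite mulf_eq0 invr_eq0 pnatr_eq0 (gtn_eqF n0) orbF => /eqP.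
Qed.

(** If all variances vanish, the functional depends only on the size because every
    tree has positive probability, and its values [nu f] serve as [a].
    Conversely a toll of this form telescopes along the tree. *)
Lemma var_eq0_telescoping : (forall n, (0 < n)%N -> V n = 0) <->
  exists a : nat -> R,
    forall (n d : nat) (ns : seq nat),
      (0 < n)%N -> size ns = d -> all (fun m => 0 < m)%N ns ->
      sumn ns = n.-1 -> g n d ns = a n - \sum_(m <- ns) a m.
Proof.
split=> [V0|[a ga] n n0].
  exists (nu f) => n d ns n0 <- /forest_of_sizes[ts <-] sn.
  have Fnu t : F t = nu f (tree_size t).
    exact: (rrt_var_eq0P (tree_size_gt0 t) (V0 _ (tree_size_gt0 t))).
  have tn : tree_size (Node ts) = n by rewrite /= sn prednK.
  have := additive_toll tn; rewrite Fnu tn /toll => ->.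
  rewrite big_map [X in _ + X - _](eq_bigr (fun s => nu f (tree_size s))) //.
  by rewrite addrK.
have Fchildren (t : tree) :
    \sum_(s <- children t) F s = \sum_(m <- principal_sizes t) a m ->
    F t = a (tree_size t).
  rewrite (additive_toll (erefl (tree_size t))) /toll ga //.
  - by move=> ->; rewrite subrK.
  - by case: t.
  - by case: t => ts; elim: ts => //= s ts ->; rewrite tree_size_gt0.
  - by case: t.
have Fa (t : tree) : F t = a (tree_size t).
  apply: (Fchildren _); elim/graft_ind: t => [|b c IHb IHc]; first by rewrite !big_nil.
  by rewrite !big_cons (Fchildren _ IHb) IHc.
rewrite /V (eq_rrt_var (Y := fun=> a n)) //; last by move=> t <-.
by rewrite /rrt_var !rrt_mean_cst subrr expr0n.
Qed.

Hypothesis hsd : (\sum_(1 <= k <oo)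
            (Num.sqrt (rrt_var k f) / (k%:R `^ (3 / 2)))%:E < +oo)%E.
Hypothesis hvar : rrt_var k f / k%:R @[k --> \oo] --> (0 : R).
Hypothesis hmean :
  (\sum_(1 <= k <oo) ((rrt_mean k f) ^+ 2 / k%:R ^+ 2)%:E < +oo)%E.

Lemma mean_series_bounded :
  exists C, forall n, \sum_(1 <= k < n) mu k ^+ 2 / k%:R ^+ 2 <= C.
Proof.
by apply: nneseries_bounded hmean => k; rewrite divr_ge0 ?sqr_ge0 ?exprn_ge0.
Qed.

(** Of the two parts of [psi_le], the first is summable by the conditions on the
    variances, and the second by the condition on the means. *)
Lemma psi_sum_cvg : cvgn psi_sum.
Proof.
have [C1 HC1] := sqrt_series_bounded (fun k => rrt_var_ge0 k f) hvar hsd.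
have [C2 HC2] := mean_series_bounded.
apply: (bounded_nnseries_cvg (C := 2 * C1 + 12 * C2)).
  by move=> k; rewrite mulr_ge0 ?psi_ge0// invr_ge0 mulr_ge0.
move=> n; have q0 k : 0 <= mu k ^+ 2 by exact: sqr_ge0.
apply: le_trans (lerD (ler_wpM2l (ler0n _ 2) (HC1 n))
  (ler_wpM2l (ler0n _ 12) (sum_harmonic_sum_le n q0 HC2))).
rewrite !mulr_sumr -big_split; apply: ler_sum_nat => k /andP[k0 _].
have kR : 0 < k%:R :> R by rewrite ltr0n.
rewrite mulrC; apply: le_trans (ler_wpM2r _ (psi_le k0)) _.
  by rewrite invr_ge0 mulr_ge0.
rewrite mulrDl -[2 * _ * _]mulrA -[12 * _ * _]mulrA lerD2r.
rewrite ler_wpM2l // ler_wpM2l ?rrt_var_ge0//.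
rewrite lef_pV2 ?posrE ?exprn_gt0 ?mulr_gt0 ?ltr0n//.
by rewrite expr2 ler_pM2l // ler_nat.
Qed.

Lemma psi_small : psi f g n / n%:R @[n --> \oo] --> (0 : R).
Proof.
have [C HC] := mean_series_bounded.
have u0 k : 0 <= mu k ^+ 2 / k%:R ^+ 2 by rewrite divr_ge0 ?sqr_ge0 ?exprn_ge0.
have /cvg_ex[l /kronecker K] := bounded_nnseries_cvg u0 HC.
apply: (squeeze_cvgr (f := fun=> 0)
  (h := fun n => 2 * (rrt_var n f / n%:R) + 12 * slope (fun j => mu j ^+ 2) n)).
- apply: nearW => -[|n]; first by rewrite /slope !invr0 !mulr0 addr0 lexx.
  rewrite divr_ge0 ?psi_ge0//=.
  rewrite /slope [2 * _]mulrA [12 * _]mulrA -mulrDl ler_wpM2r ?invr_ge0//; exact: psi_le.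
- exact: cvg_cst.
- have := cvgD (cvgMl_tmp (a := 2) hvar) (cvgMl_tmp (a := 12) K).
  by rewrite !mulr0 addr0; exact.
Qed.

Lemma var_additive_cvg : rrt_var n F / n%:R @[n --> \oo] --> limn psi_sum.
Proof.
under eq_fun do rewrite var_additiveE.
by have := cvgD psi_small psi_sum_cvg; rewrite add0r; exact.
Qed.

Lemma limn_psi_sum_gt0 : 0 < limn psi_sum <->
  ~ (forall n, (0 < n)%N -> rrt_var n F = 0).
Proof.
rewrite var_eq0_psi; split=> [l0 H|H].
  move: l0; rewrite (_ : psi_sum = fun=> 0) ?lim_cst ?ltxx//.
  apply/funext => n; rewrite /psi_sum big_nat big1// => k /andP[k0 _].
  by rewrite H // mulr0.
rewrite ltNge; apply/negP => l0; apply: H => n n0.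
have mono : {homo psi_sum : i j / (i <= j)%N >-> i <= j}.
  apply/nondecreasing_seqP => -[|i]; first by rewrite /psi_sum !big_geq.
  by rewrite /psi_sum [leRHS]big_nat_recr //= lerDl mulr_ge0 ?psi_ge0//.
have := le_trans (nondecreasing_cvgn_le mono psi_sum_cvg n.+1) l0.
rewrite /psi_sum big_nat_recr //= => le0.
have c0 : 0 < (n%:R * n.+1%:R)^-1 :> R by rewrite invr_gt0 mulr_gt0 ?ltr0n.
apply/eqP; rewrite eq_le psi_ge0 andbT -(pmulr_rle0 _ c0); apply: le_trans le0.
by rewrite lerDr sumr_ge0 // => k _; rewrite mulr_ge0 ?psi_ge0// invr_ge0 mulr_ge0.
Qed.

End SizeFunctional.

Unset Implicit Arguments.

Theorem theorem1p30 (R : realType) (f : tree -> R)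
  (g : nat -> nat -> seq nat -> R)
  (hsd : (\sum_(1 <= k <oo)
            (Num.sqrt (rrt_var k f) / (k%:R `^ (3 / 2)))%:E < +oo)%E)
  (hvar : rrt_var k f / k%:R @[k --> \oo] --> (0 : R))
  (hmean : (\sum_(1 <= k <oo) ((rrt_mean k f) ^+ 2 / k%:R ^+ 2)%:E < +oo)%E)
  (hg : forall t : tree,
      f t = g (tree_size t) (root_degree t) (principal_sizes t)) :
  [/\ forall k : nat, (0 < k)%N ->
        psi f g k = rrt_mean k (fun t => (psi_variable f g k t - nu f k) ^+ 2),
      cvgn (fun n : nat => rrt_var n (additive_functional f) / n%:R),
      ((sigma2 f)%:E =
         \sum_(1 <= k <oo) ((k%:R * k.+1%:R)^-1 * psi f g k)%:E)%E /\
      (\sum_(1 <= k <oo) ((k%:R * k.+1%:R)^-1 * psi f g k)%:E < +oo)%E,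
      0 < sigma2 f <->
        ~ (forall n : nat, (0 < n)%N -> rrt_var n (additive_functional f) = 0) &
      (forall n : nat, (0 < n)%N -> rrt_var n (additive_functional f) = 0) <->
        exists a : nat -> R,
          forall (n d : nat) (ns : seq nat),
            (0 < n)%N -> size ns = d -> all (fun m => 0 < m)%N ns ->
            sumn ns = n.-1 ->
            g n d ns = a n - \sum_(m <- ns) a m].
Proof.
have cvgV := var_additive_cvg hg hsd hvar hmean.
have sE : sigma2 f = limn (psi_sum f g) by exact: cvg_lim cvgV.
have serE : (\sum_(1 <= k <oo) ((k%:R * k.+1%:R)^-1 * psi f g k)%:E)%E =
    (sigma2 f)%:E by rewrite sE; exact: eseries_EFin (psi_sum_cvg hg hsd hvar hmean).
split.
- by move=> k k0; rewrite /psi /rrt_var (rrt_mean_psi_variable hg).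
- exact: cvgP cvgV.
- by rewrite serE ltry.
- by rewrite sE; exact: limn_psi_sum_gt0.
- exact: var_eq0_telescoping.
Qed.
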